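(* Let $i,w$ be positive integers with $w\ge i$. There is $n_0(i,w)$ such that for all $n\ge n_0(i,w)$ and any nonzero $\lambda_i(n,w)$-eigenfunction $f$ of the Johnson graph $J(n,w)$, where $\lambda_i(n,w)=(w-i)(n-w-i)-i$, the following holds: $$|\mathrm{supp}(f)|\ \ge\ 2^i\binom{n-2i}{w-i},$$ with equality attained only for the function $f^{i,w,n}$ up to multiplication by a scalar; that is, if $|\mathrm{supp}(f)|=2^i\binom{n-2i}{w-i}$, then there are disjoint sets $M,M'\subseteq\{1,\dots,n\}$ of size $i$, a bijection $':M\to M'$ and a real scalar $c$ such that $f=c\cdot f^{i,w,n}$, where $f^{i,w,n}$ is the function determined by $M$, $M'$ and this bijection.
   Context: The vertices of the Johnson graph $J(n,w)$ are the binary vectors of length $n$ with exactly $w$ ones; two vertices are adjacent if they have exactly $w-1$ common ones. For a binary vector $x$ of length $n$, $\mathrm{supp}(x)\subseteq\{1,\dots,n\}$ is the set of positions where $x$ is nonzero. For a real-valued function $f$ on the vertices, $\mathrm{supp}(f)$ is the set of vertices at which $f$ is nonzero. A real-valued function $f$ on the vertices of a graph $G=(V,E)$ is a $\lambda$-eigenfunction of $G$ if $\lambda f(x)=\sum_{y\in V:(x,y)\in E} f(y)$ for every $x\in V$ (the all-zero function is allowed by this definition; ''nonzero eigenfunction'' means it is not identically zero). Definition of $f^{i,w,n}$: let $M$ and $M'$ be two disjoint sets of coordinate positions in $\{1,\dots,n\}$, each of size $i$, whose elements are in a one-to-one correspondence $m\mapsto m'$ from $M$ onto $M'$. For $I\subseteq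 M$ put $I'=\{m':m\in I\}\subseteq M'$. For a binary vector $x$ of length $n$ and weight $w$, $$f^{i,w,n}(x)=(-1)^{|M\cap \mathrm{supp}(x)|}\quad\text{if } |\mathrm{supp}(x)\cap(M\cup M')|=i \text{ and } (\mathrm{supp}(x)\cap M)'\cup(\mathrm{supp}(x)\cap M')=M',$$ and $f^{i,w,n}(x)=0$ otherwise. (Equivalently, $f^{i,w,n}(x)\ne 0$ iff $\mathrm{supp}(x)$ contains exactly one element of each pair $\{m,m'\}$, $m\in M$.) *)

(* Defs.v *)
From mathcomp Require Import all_boot all_order all_algebra.
From mathcomp Require Import reals.

Set Implicit Arguments.
Unset Strict Implicit.
Unset Printing Implicit Defensive.

Import Order.TTheory GRing.Theory Num.Theory.
Local Open Scope ring_scope.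

(* Coordinate positions {1, ..., n} are represented by 'I_n = {0, ..., n-1}. *)
Definition bvec (n : nat) := {ffun 'I_n -> bool}.

Definition bsupp (n : nat) (x : bvec n) : {set 'I_n} := [set k | x k].

Definition jvertex (n w : nat) := {x : bvec n | #|bsupp x| == w}.

Definition jsupp (n w : nat) (x : jvertex n w) : {set 'I_n} := bsupp (val x).

(* The predecessor is truncated at w = 0; J(n, w) is only meant for 0 < w,
   in which case the relation is irreflexive. *)
Definition johnson (n w : nat) : rel (jvertex n w) :=
  fun x y => #|jsupp x :&: jsupp y| == w.-1.

Definition eigenfunction (R : realType) (V : finType) (e : rel V) (lambda : R)
    (f : V -> R) : Prop :=
  forall x : V, lambda * f x = \sum_(y | e x y) f y.

Definition fsupp (R : realType) (V : finType) (f : V -> R) : {set V} :=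
  [set x | f x != 0].

(* Computed in R, so that n - w - i is a genuine difference. *)
Definition johnson_eigenvalue (R : realType) (i w n : nat) : R :=
  (w%:R - i%:R) * (n%:R - w%:R - i%:R) - i%:R.

(* The bijection m |-> m' from M onto M' is a total map phi on coordinates of
   which only the restriction to M matters. *)
Definition is_pairing (i n : nat) (M M' : {set 'I_n}) (phi : 'I_n -> 'I_n) :
    Prop :=
  [/\ #|M| = i, #|M'| = i, [disjoint M & M'],
      {in M &, injective phi} & phi @: M = M'].

Definition min_eigenfun (R : realType) (i w n : nat) (M M' : {set 'I_n})
    (phi : 'I_n -> 'I_n) (x : jvertex n w) : R :=
  if (#|jsupp x :&: (M :|: M')| == i)
     && (phi @: (jsupp x :&: M) :|: (jsupp x :&: M') == M')
  then (-1) ^+ #|M :&: jsupp x| else 0.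

(* Main.v *)
Require Import Defs.
From mathcomp Require Import all_boot all_order all_algebra.
From mathcomp Require Import reals zify ring.

(** Functions on vertices are handled as functions [f] on finite sets, so that
the difference [coord_diff j k f] of [f] along two coordinates [j], [k] lives
on the sets that avoid [j] and [k] without any change of type.

Write [K] for the binomial coefficient of [n - 2 * i] over [w - i]. The
difference along [j], [k] of a [lambda_i]-eigenfunction of [J(n, w)] is a
[lambda_(i-1)]-eigenfunction of [J(n-2, w-1)], and each nonzero of the
difference comes from a nonzero of [f] at a set that contains exactly one of
[j], [k]. After [i] such steps one reaches a nonzero constant, which gives the
weak bound [K <= #|supp f|] ([eigen_support_weak]).

Suppose now that [#|supp f| <= 2 ^ i * K]. Call [j] and [k] twins when the
difference of [f] along them vanishes. Every pair of non-twins accounts for at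
least [K] nonzeros by the weak bound, whereas a nonzero has only [w] ones, so
there are only linearly many pairs of non-twins. Hence all coordinates but a
bounded set [C] are twins of each other ([twin_block]), and [f X] depends on
the trace of [X] on [C] only ([twin_class_trace]).

For a trace [S], the number of [w]-sets with trace [S] is a polynomial in [n]
of degree [w - #|S|], while [K] has degree [w - i]. So for large [n] a nonzero
of [f] cannot have a trace smaller than [i] (there would be too many
nonzeros), and some nonzero has a trace of size exactly [i] (otherwise there
would be fewer than [K]). Restricted to traces of size [i], [f] becomes a
function [h] on [i]-subsets of [C]; the eigenvalue equation at a set with a
trace of size [i - 1] says that [h] is a null design, i.e. that the sum of [h]
over the [i]-sets containing a given [(i-1)]-set is zero
([trace_fun_null]).

A nonzero null design has at least [2 ^ i] nonzeros, since for a nonzero [S]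
every subset of [S] is the intersection of [S] with some nonzero
([null_design_support_ge]). If there are exactly [2 ^ i], the values at the
nonzeros are equal up to a sign given by the size of the differences, and a
parity argument shows that the nonzeros are the transversals of [i] disjoint
pairs ([min_null_design_structure]). Comparing leading coefficients, [h] has
exactly [2 ^ i] nonzeros. Finally [C] is the union of the pairs: for another
coordinate [j] of [C], the difference of [f] along [j] and a coordinate
outside [C] would have fewer than [K] nonzeros. So [#|C| = 2 * i], the
nonzeros whose trace has size [i] already number [2 ^ i * K], and there are no
others. *)

Set Implicit Arguments.
Unset Strict Implicit.
Unset Printing Implicit Defensive.

Import Order.TTheory GRing.Theory Num.Theory.
Local Open Scope ring_scope.

(** * Growth of binomial coefficients *)

Section Growth.
Local Open Scope nat_scope.

Lemma leq_bin_exp n k : 'C(n, k) <= n ^ k.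
Proof.
apply: leq_trans (_ : n ^_ k <= _).
  by rewrite -bin_ffact leq_pmulr ?fact_gt0.
elim: k => [|k IHk]; first by rewrite ffactn0.
by rewrite ffactnSr expnSr leq_mul ?leq_subr.
Qed.

Lemma leq_exp_ffact n k : (n - k) ^ k <= n ^_ k.
Proof.
suff H l : l <= k -> (n - k) ^ l <= n ^_ l by exact: H.
elim: l => [|l IHl] lk; first by rewrite ffactn0.
rewrite ffactnSr expnSr leq_mul ?IHl ?(ltnW lk) //; lia.
Qed.

(** The sum is a polynomial in [n] of degree less than [b], the right-hand side
one of degree [b]. *)
Lemma bin_growth (A D W : nat) : exists n0, forall n b, n0 <= n -> b <= W ->
  A * (\sum_(a < b) 'C(n, a)) < 'C(n - D, b).
Proof.
exists (maxn (2 * (D + W)) (2 ^ W * W`! * A * W).+1) => n b.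
rewrite geq_max => /andP[nDW nA] bW.
case: b bW => [|b] bW; first by rewrite big_ord0 muln0 bin0.
have n_gt0 : 0 < n by exact: leq_trans nA.
have sum_le : \sum_(a < b.+1) 'C(n, a) <= W * n ^ b.
  apply: leq_trans (_ : \sum_(a < b.+1) n ^ b <= _).
    apply: leq_sum => a _; apply: leq_trans (leq_bin_exp _ _) _.
    by rewrite leq_pexp2l // -ltnS.
  by rewrite sum_nat_const card_ord leq_mul.
have bin_ge : n ^ b.+1 <= 2 ^ W * W`! * 'C(n - D, b.+1).
  apply: leq_trans (_ : 2 ^ b.+1 * (n - D) ^_ b.+1 <= _).
    apply: leq_trans (leq_mul (leqnn _) (leq_exp_ffact _ _)).
    rewrite -expnMn leq_exp2r //; lia.
  rewrite -bin_ffact ['C(_, _) * _]mulnC mulnA leq_mul2r leq_mul ?orbT //.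
    by rewrite leq_pexp2l.
  by rewrite leq_fact.
have c_gt0 : 0 < 2 ^ W * W`! by rewrite muln_gt0 expn_gt0 fact_gt0.
rewrite -(ltn_pmul2l c_gt0); apply: leq_trans bin_ge.
apply: leq_ltn_trans (leq_mul (leqnn _) (leq_mul (leqnn A) sum_le)) _.
by rewrite expnS !mulnA ltn_mul2r expn_gt0 n_gt0.
Qed.

Lemma leq_bin_sub n D b : 'C(n, b.+1) <= 'C(n - D, b.+1) + D * 'C(n, b).
Proof.
elim: D => [|D IHD]; first by rewrite subn0 addn0.
apply: leq_trans IHD _; rewrite mulSn addnA leq_add2r.
case: (leqP n D) => [nD|Dn].
  by rewrite (_ : n - D.+1 = n - D) ?leq_addr //; lia.
rewrite (_ : n - D = (n - D.+1).+1); last lia.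
by rewrite binS leq_add2l leq_bin2l // leq_subr.
Qed.

(** The two binomial coefficients have the same leading term, so the factor
[A.+1 / A] eventually wins. *)
Lemma bin_shift (A D W : nat) : exists n0, forall n b, n0 <= n -> b <= W ->
  A * 'C(n, b) < A.+1 * 'C(n - D, b).
Proof.
have [n0 Hn0] := bin_growth (A * D) D W; exists n0 => n [|b] n0n bW.
  by rewrite !bin0 !muln1.
apply: leq_ltn_trans (leq_mul (leqnn A) (leq_bin_sub n D b)) _.
rewrite mulnDr mulSn addnC ltn_add2r mulnA.
apply: leq_ltn_trans (Hn0 _ _ n0n bW).
by rewrite big_ord_recr mulnDr leq_addl.
Qed.

End Growth.

(** * Null designs of minimum support *)

Section NullDesigns.
Variables (R : numDomainType) (T : finType) (i : nat) (h : {set T} -> R).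
Hypothesis h_uniform : forall A, h A != 0 -> #|A| = i.
Hypothesis h_null : forall U : {set T}, (#|U|.+1 = i)%N ->
  \sum_(b in ~: U) h (b |: U) = 0.

(** Double counting of the pairs formed by a set above [D] and one of its
elements outside [D]. *)
Lemma null_design_cover_sum (D : {set T}) :
  (i - #|D|)%:R * \sum_(A : {set T} | D \subset A) h A =
  \sum_(b in ~: D) \sum_(A : {set T} | b |: D \subset A) h A.
Proof.
rewrite (exchange_big_dep (fun A : {set T} => D \subset A)) /=; last first.
  by move=> b A _; apply: subset_trans; exact: subsetU1.
rewrite mulr_sumr; apply: eq_bigr => A DA.
have [->|hA] := eqVneq (h A) 0; first by rewrite mulr0 big1.
rewrite (eq_bigl (mem (A :\: D))); last first.
  by move=> b; rewrite !inE subUset sub1set DA andbT.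
by rewrite sumr_const cardsD (setIidPr DA) (h_uniform hA) mulr_natl.
Qed.

(** Vanishing passes from [(i-1)]-sets down to all smaller sets, because the
factor [i - #|D|] in [null_design_cover_sum] is nonzero. *)
Lemma null_design_sum (D : {set T}) : (#|D| < i)%N ->
  \sum_(A : {set T} | D \subset A) h A = 0.
Proof.
move Em : (i - #|D|)%N => m; elim: m D Em => [|m IHm] D Em Di; first lia.
have : (i - #|D|)%:R * \sum_(A : {set T} | D \subset A) h A = 0.
  rewrite null_design_cover_sum.
  case: (ltnP #|D|.+1 i) => [D1i|iD1].
    apply: big1 => b; rewrite inE => bD.
    by apply: IHm; rewrite cardsU1 bD //=; lia.
  rewrite -[RHS](h_null (U := D)); last lia.
  apply: eq_bigr => b; rewrite inE => bD.
  have cbD : #|b |: D| = i by rewrite cardsU1 bD /=; lia.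
  rewrite (bigD1 (b |: D)) //= big1 ?addr0 // => A /andP[bDA neA].
  apply/eqP/contraT => /h_uniform cA; case/eqP: neA; apply/esym/eqP.
  by rewrite eqEcard bDA cA cbD leqnn.
by move/eqP; rewrite mulf_eq0 pnatr_eq0 => /orP[|/eqP//]; rewrite subn_eq0; lia.
Qed.

Lemma trace_sum_split (E D : {set T}) (a : T) : a \in E -> a \notin D ->
  \sum_(A : {set T} | A :&: E == D) h A =
  \sum_(A : {set T} | A :&: (E :\ a) == D) h A -
  \sum_(A : {set T} | A :&: E == a |: D) h A.
Proof.
move=> aE aD; apply/esym/eqP; rewrite subr_eq; apply/eqP.
rewrite [RHS]addrC (bigID [pred A : {set T} | a \in A]) /=; congr (_ + _).
  apply: eq_bigl => A; apply/andP/eqP.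
    case=> /eqP <- aA; apply/setP => x; rewrite !inE.
    by case: eqP => //= ->; rewrite aA aE.
  move=> AE; have : a \in A :&: E by rewrite AE setU11.
  rewrite inE aE andbT => aA; split=> //; apply/eqP/setP => x.
  move/setP/(_ x): AE; rewrite !inE; case: eqP => [-> _|_ ->] //=.
  by rewrite andbF (negPf aD).
apply: eq_bigl => A; apply/andP/eqP.
  case=> /eqP <- aA; apply/setP => x; rewrite !inE.
  by case: eqP => //= ->; rewrite (negPf aA).
move=> AE; have aA : a \notin A.
  by apply: contra aD => aA; rewrite -AE inE aA.
split=> //; apply/eqP/setP => x; move/setP/(_ x): AE; rewrite !inE.
by case: eqP => [-> _|_ ->] //=; rewrite andbF (negPf aD).
Qed.

(** Inclusion-exclusion: prescribing the trace on [E] only involves the sums of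
[h] over the sets containing some set of size less than [i]. *)
Lemma null_design_trace_sum0 (E D : {set T}) : D \subset E -> (#|E| < i)%N ->
  \sum_(A : {set T} | A :&: E == D) h A = 0.
Proof.
move Em : #|E :\: D| => m; elim: m E D Em => [|m IHm] E D Em DE Ei.
  have -> : D = E by apply/eqP; rewrite eqEsubset DE -setD_eq0 -cards_eq0 Em.
  rewrite -[RHS](null_design_sum Ei); apply: eq_bigl => A.
  by apply/eqP/setIidPr.
have /card_gt0P[a] : (0 < #|E :\: D|)%N by rewrite Em.
rewrite inE => /andP[aD aE].
have cE := cardsD1 a E; rewrite aE in cE.
have cD : #|E :\: (a |: D)| = m.
  have := cardsD1 a (E :\: D); rewrite inE aD aE Em add1n => -[->].
  by apply: eq_card => x; rewrite !inE negb_or andbA.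
rewrite (trace_sum_split aE aD) !IHm ?subrr //; try lia.
- by rewrite subUset sub1set aE.
- by rewrite -cD; apply: eq_card => x; rewrite !inE negb_or andbCA andbA.
- by apply/subsetP => x xD; rewrite !inE (subsetP DE) // andbT; apply: contraNneq aD => <-.
Qed.

(** Here only the sum of [h] over the sets containing [S] survives in the
inclusion-exclusion formula, and it is [h S] as all sets have size [i]. *)
Lemma null_design_trace_sum (S D : {set T}) : h S != 0 -> D \subset S ->
  \sum_(A : {set T} | A :&: S == D) h A = (-1) ^+ #|S :\: D| * h S.
Proof.
move=> hS; have cS := h_uniform hS.
move Em : #|S :\: D| => m; elim: m D Em => [|m IHm] D Em DS.
  have -> : D = S by apply/eqP; rewrite eqEsubset DS -setD_eq0 -cards_eq0 Em.
  rewrite mul1r (bigD1 S) ?setIid //= big1 ?addr0 // => A /andP[/eqP/setIidPr SA neA].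
  apply/eqP/contraT => /h_uniform cA; case/eqP: neA; apply/esym/eqP.
  by rewrite eqEcard SA cA cS leqnn.
have /card_gt0P[a] : (0 < #|S :\: D|)%N by rewrite Em.
rewrite inE => /andP[aD aS].
have cSa := cardsD1 a S; rewrite aS in cSa.
have cD : #|S :\: (a |: D)| = m.
  have := cardsD1 a (S :\: D); rewrite inE aD aS Em add1n => -[->].
  by apply: eq_card => x; rewrite !inE negb_or andbA.
rewrite (trace_sum_split aS aD) IHm ?subUset ?sub1set ?aS //.
rewrite null_design_trace_sum0 ?sub0r ?exprS ?mulN1r ?mulNr //; last lia.
by apply/subsetP => x xD; rewrite !inE (subsetP DS) // andbT; apply: contraNneq aD => <-.
Qed.

Lemma null_design_trace_witness (S D : {set T}) : h S != 0 -> D \subset S ->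
  exists2 A : {set T}, h A != 0 & A :&: S = D.
Proof.
move=> hS DS; have /eqP := null_design_trace_sum hS DS.
case: (pickP [pred A | (h A != 0) && (A :&: S == D)]) => [A /andP[hA /eqP]|noA].
  by exists A.
rewrite big1 => [|A AS]; last first.
  by move: (noA A); rewrite /= AS andbT => /negPn/eqP.
by rewrite eq_sym mulf_eq0 signr_eq0 (negPf hS).
Qed.

Local Notation supp := [set A : {set T} | h A != 0].

Lemma null_design_traces (S : {set T}) : h S != 0 ->
  [set A :&: S | A in supp] = powerset S.
Proof.
move=> hS; apply/setP => D; rewrite powersetE; apply/imsetP/idP.
  by case=> A _ ->; exact: subsetIr.
move=> /(null_design_trace_witness hS)[A hA <-]; exists A; rewrite ?inE //.
Qed.

Lemma null_design_support_ge (S : {set T}) : h S != 0 -> (2 ^ i <= #|supp|)%N.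
Proof.
move=> hS; rewrite -(h_uniform hS) -card_powerset -(null_design_traces hS).
exact: leq_imset_card.
Qed.

Hypothesis supp_min : #|supp| = (2 ^ i)%N.

Lemma min_null_design_trace_inj (S : {set T}) : h S != 0 ->
  {in supp &, injective (fun A => A :&: S)}.
Proof.
move=> hS; apply/imset_injP; rewrite null_design_traces // card_powerset.
by rewrite supp_min (h_uniform hS).
Qed.

(** In the minimum case the sum in [null_design_trace_sum] has a single nonzero
term. *)
Lemma min_null_design_value (S A : {set T}) : h S != 0 -> h A != 0 ->
  h A = (-1) ^+ #|S :\: A| * h S.
Proof.
move=> hS hA; have := null_design_trace_sum hS (subsetIr A S).
rewrite setDIr setDv setU0 => <-.
rewrite (bigD1 A) //= big1 ?addr0 // => B /andP[/eqP BS neB].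
apply/eqP/contraT => hB; case/eqP: neB.
by apply: (min_null_design_trace_inj hS); rewrite ?inE.
Qed.

(** Exchanging [a] for [b] changes the sign of [h]. If [A] contained both or
neither of [a], [b], it would differ from [S] and from the exchanged set by the
same number of elements, so the value [h A] would be obtained from two opposite
numbers by the same sign. *)
Lemma min_null_design_pair (S A : {set T}) (a b : T) :
    a \in S -> b \notin S -> h S != 0 -> h (b |: (S :\ a)) != 0 -> h A != 0 ->
  (a \in A) (+) (b \in A).
Proof.
move=> aS bS hS hS' hA; apply: contraT => abA.
have := min_null_design_value hS' hA; rewrite (min_null_design_value hS hS').
rewrite (min_null_design_value hS hA).
have -> : S :\: (b |: (S :\ a)) = [set a].
  apply/setP => x; rewrite !inE; have [->|xa] /= := eqVneq x a.
    by rewrite aS orbF andbT; apply: contraNneq bS => <-.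
  by case: (x \in S); rewrite ?orbT ?andbF.
rewrite cards1 expr1 mulN1r mulrN => /eqP.
suff -> : #|(b |: (S :\ a)) :\: A| = #|S :\: A|.
  rewrite -addr_eq0 -mulr2n mulrn_eq0 /= mulf_eq0 signr_eq0 /= => hS0.
  by rewrite hS0 in hS.
have bSa : b \notin S :\ a by rewrite !inE (negPf bS) andbF.
rewrite (cardsD1 b) (cardsD1 a (S :\: A)) !inE eqxx aS /= andbT.
move: abA; case: (boolP (a \in A)) => aA; case: (boolP (b \in A)) => bA //= _;
  congr (_ + _)%N; apply: eq_card => x; rewrite !inE;
  case: (eqVneq x b) => [->|_] //=; rewrite ?(negPf bS) ?andbF //=;
  by case: (eqVneq x a) => [->|_] //=; rewrite ?andbF.
Qed.

(** Nonvanishing condition of the extremal function, for an arbitrary set of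
coordinates in place of the support of a vertex. *)
Definition is_pair_transversal (M M' : {set T}) (phi : T -> T) (A : {set T}) :=
  (#|A :&: (M :|: M')| == #|M|) && (phi @: (A :&: M) :|: (A :&: M') == M').

(** The trace [M :\ a] is realised by a nonzero that exchanges [a] for some
[phi a], and by [min_null_design_pair] every nonzero contains exactly one of
[a], [phi a]. As there are [i] such pairs, this determines a nonzero from its
trace on [M], and all traces occur. *)
Lemma min_null_design_structure (M : {set T}) : h M != 0 ->
  exists phi : T -> T,
    [/\ [disjoint M & phi @: M], {in M &, injective phi},
        {in M, forall a, h (phi a |: (M :\ a)) != 0},
        forall A, h A != 0 -> A \subset M :|: phi @: M &
        forall A : {set T}, A \subset M :|: phi @: M ->
          h A = (-1) ^+ i * h M *
            (if is_pair_transversal M (phi @: M) phi A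
             then (-1) ^+ #|M :&: A| else 0)].
Proof.
move=> hM; have cM := h_uniform hM.
pose phi a := odflt a [pick b | (b \notin M) && (h (b |: (M :\ a)) != 0)].
have phiP a : a \in M -> (phi a \notin M) && (h (phi a |: (M :\ a)) != 0).
  rewrite /phi => aM; case: pickP => //= no_b.
  have [A hA AM] := null_design_trace_witness hM (subD1set M a).
  have /card_gt0P[b] : (0 < #|A :\: M|)%N.
    have := cardsID M A; rewrite AM (h_uniform hA).
    by have := cardsD1 a M; rewrite aM cM; lia.
  rewrite inE => /andP[bM bA]; have := no_b b; rewrite bM /=.
  suff -> : b |: M :\ a = A by rewrite hA.
  apply/eqP; rewrite eqEcard subUset sub1set bA -AM subsetIl /= AM.
  rewrite (h_uniform hA) cardsU1 !inE (negPf bM) andbF /=.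
  by have := cardsD1 a M; rewrite aM cM => ->.
have phiM a : a \in M -> phi a \notin M by case/phiP/andP.
have phih a : a \in M -> h (phi a |: (M :\ a)) != 0 by case/phiP/andP.
have phi_pair a A : a \in M -> h A != 0 -> (phi a \in A) = (a \notin A).
  move=> aM hA; have := min_null_design_pair aM (phiM a aM) hM (phih a aM) hA.
  by case: (a \in A) => /=; case: (phi a \in A).
have phi_inj : {in M &, injective phi}.
  move=> a b aM bM ab; apply/eqP/contraT => neab.
  have := phi_pair b _ bM (phih a aM).
  by rewrite -ab setU11 !inE [b == a]eq_sym neab bM orbT.
have disj : [disjoint M & phi @: M].
  rewrite disjoint_sym disjoint_subset; apply/subsetP => _ /imsetP[a aM ->].
  by rewrite inE; exact: phiM.
have cPhi (B : {set T}) : B \subset M -> #|phi @: B| = #|B|.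
  by move=> /subsetP BM; apply: card_in_imset => x y /BM xM /BM yM; exact: phi_inj.
have cardI A : #|A :&: (M :|: phi @: M)| = (#|A :&: M| + #|A :&: (phi @: M)|)%N.
  rewrite setIUr cardsU [X in (_ - X)%N](_ : _ = 0%N) ?subn0 //.
  apply/eqP; rewrite cards_eq0 -subset0 -(disjoint_setI0 disj).
  by rewrite setIACA setIid subsetIr.
have traceM' A : h A != 0 -> A :&: (phi @: M) = phi @: (M :\: A).
  move=> hA; apply/setP => y; rewrite inE; apply/andP/imsetP.
    case=> yA /imsetP[a aM ya]; exists a => //; rewrite inE aM andbT.
    by rewrite -phi_pair // -ya.
  case=> a; rewrite inE => /andP[aA aM] ->.
  by rewrite phi_pair // imset_f.
have cAM (A : {set T}) : (#|A :&: M| + #|M :\: A| = i)%N.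
  by rewrite -cM -(cardsID A M) setIC.
have cPhiD A : #|phi @: (M :\: A)| = #|M :\: A| by rewrite cPhi ?subsetDl.
have sub A : h A != 0 -> A \subset M :|: phi @: M.
  move=> hA; apply/setIidPl/eqP; rewrite eqEcard subsetIl /= cardI traceM' //.
  by rewrite cPhiD cAM (h_uniform hA).
exists phi; split=> // A AMM'.
case: ifP => [/andP[/eqP cA /eqP covA]|noA].
  have DM' : phi @: (M :\: A) \subset A :&: (phi @: M).
    apply/subsetP => y /imsetP[a]; rewrite inE => /andP[aA aM] {y}->.
    have : phi a \in phi @: (A :&: M) :|: (A :&: phi @: M) by rewrite covA imset_f.
    rewrite inE => /orP[/imsetP[b]|//]; rewrite inE => /andP[bA bM] eab.
    by case/negP: aA; rewrite (phi_inj a b).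
  have eqM' : phi @: (M :\: A) = A :&: (phi @: M).
    apply/eqP; rewrite eqEcard DM' cPhiD /=.
    by move: cA; rewrite cardI cM -(cAM A); lia.
  have [B hB BM] := null_design_trace_witness hM (subsetIr A M).
  have AB : A = B.
    rewrite -(setIidPl AMM') -(setIidPl (sub B hB)) !setIUr BM -eqM' traceM' //.
    congr (_ :|: phi @: _).
    by rewrite -[M :\: A]set0U -(setDv M) -setDIr setIC -BM setIC setDIr setDv set0U.
  rewrite {1}AB (min_null_design_value hM hB) -AB mulrAC; congr (_ * _).
  rewrite -(cAM A) exprD [A :&: M]setIC mulrC mulrA -exprD.
  by rewrite addnn -mul2n exprM sqrrN !expr1n mul1r.
rewrite mulr0; apply/eqP/contraT => hA; case/negP: noA; apply/andP; split.
  by rewrite cardI traceM' // cPhiD cAM cM.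
rewrite traceM' // -imsetU; apply/eqP; congr (phi @: _).
by rewrite setIC setID.
Qed.
End NullDesigns.

(** * Eigenfunctions and their coordinate differences *)

Section Eigen.
Variables (R : realType) (T : finType).
Implicit Types (V X Y Z : {set T}) (f : {set T} -> R) (i j k w : nat).

Definition exchange (a b : T) X := b |: (X :\ a).

Lemma exchange_card a b X : a \in X -> b \notin X -> #|exchange a b X| = #|X|.
Proof.
by move=> aX bX; rewrite cardsU1 !inE (negPf bX) andbF [RHS](cardsD1 a) aX.
Qed.

Lemma exchange_sub a b X V : X \subset V -> b \in V -> exchange a b X \subset V.
Proof.
by move=> XV bV; rewrite subUset sub1set bV (subset_trans (subD1set _ _)).
Qed.

(** Connectivity of the Johnson graph on the subsets of [V]. *)
Lemma exchange_connected V X Z (P : {set T} -> Prop) :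
    (forall Y a b, Y \subset V -> #|Y| = #|X| -> P Y ->
       a \in Y -> b \in V :\: Y -> P (exchange a b Y)) ->
    X \subset V -> Z \subset V -> #|Z| = #|X| -> P X -> P Z.
Proof.
move=> Pex XV ZV cZ PX.
suff H n : forall Y, #|Y :\: Z| = n -> Y \subset V -> #|Y| = #|X| -> P Y -> P Z.
  exact: H XV _ PX.
elim: n => [|n IHn] Y cYZ YV cY PY.
  suff <- : Y = Z by [].
  apply/eqP; rewrite eqEcard cY cZ leqnn andbT -setD_eq0 -cards_eq0.
  exact/eqP.
have cI := cardsID Z Y; have cI' := cardsID Y Z; rewrite setIC in cI'.
have /card_gt0P[a] : (0 < #|Y :\: Z|)%N by rewrite cYZ.
rewrite inE => /andP[aZ aY].
have /card_gt0P[b] : (0 < #|Z :\: Y|)%N by lia.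
rewrite inE => /andP[bY bZ].
have bV : b \in V by exact: (subsetP ZV).
apply: (IHn (exchange a b Y)).
- have := cardsD1 a (Y :\: Z); rewrite inE aZ aY cYZ => -[->].
  apply: eq_card => x; rewrite !inE.
  by have [->|_] /= := eqVneq x b; rewrite ?bZ ?andbF //= andbCA.
- exact: exchange_sub.
- by rewrite exchange_card.
- by apply: Pex; rewrite // inE bY.
Qed.

(** The eigenfunction equation of the Johnson graph of [w]-subsets of [V], with
neighbours listed as exchanges. *)
Definition set_eigen V w (lambda : R) f := forall X, X \subset V -> #|X| = w ->
  lambda * f X = \sum_(a in X) \sum_(b in V :\: X) f (exchange a b X).

Definition coord_diff (j k : T) f Y := f (j |: Y) - f (k |: Y).

Definition supp_on V w f := [set X : {set T} | [&& X \subset V, #|X| == w & f X != 0]].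

Lemma in_supp_on V w f X :
  (X \in supp_on V w f) = [&& X \subset V, #|X| == w & f X != 0].
Proof. by rewrite inE. Qed.

(** The neighbours of [j |: Y], sorted by whether [j] leaves and whether [k]
enters. When the roles of [j] and [k] are swapped, the second and third terms
are unchanged, so that they cancel in the difference. *)
Lemma exchange_sum_split V (j k : T) Y f : j != k -> j \in V -> k \in V ->
    Y \subset V :\: [set j; k] ->
  \sum_(a in j |: Y) \sum_(b in V :\: (j |: Y)) f (exchange a b (j |: Y)) =
  f (k |: Y) + \sum_(b in (V :\: [set j; k]) :\: Y) f (b |: Y) +
  \sum_(a in Y) f (j |: (k |: (Y :\ a))) +
  \sum_(a in Y) \sum_(b in (V :\: [set j; k]) :\: Y) f (j |: exchange a b Y).
Proof.
move=> jk jV kV YV.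
have jY : j \notin Y by apply/negP => /(subsetP YV); rewrite !inE eqxx.
have kY : k \notin Y by apply/negP => /(subsetP YV); rewrite !inE eqxx orbT.
have -> : V :\: (j |: Y) = k |: ((V :\: [set j; k]) :\: Y).
  apply/setP => x; rewrite !inE; have [->|xk] /= := eqVneq x k.
    by rewrite kV (negPf kY) orbF eq_sym jk.
  by rewrite orbF negb_or andbA [_ && (x \notin Y)]andbC.
have kW : k \notin (V :\: [set j; k]) :\: Y by rewrite !inE eqxx orbT andbF.
rewrite big_setU1 //= big_setU1 //= -!addrA; congr (_ + _).
  by rewrite /exchange setU1K.
congr (_ + _); first by apply: eq_bigr => b _; rewrite /exchange setU1K.
rewrite -big_split /=; apply: eq_bigr => a aY.
have D : (j |: Y) :\ a = j |: (Y :\ a).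
  by rewrite setDUl; congr (_ :|: _); apply/setDidPl;
     rewrite disjoints1 inE; apply: contraNneq jY => ->.
rewrite big_setU1 //= /exchange D setUCA; congr (_ + _).
by apply: eq_bigr => b _; rewrite setUCA.
Qed.

(** The shift of the eigenvalue by [1] comes from the edge between [j |: Y] and
[k |: Y]. *)
Lemma coord_diff_eigen V w lambda f (j k : T) : j != k -> j \in V -> k \in V ->
  set_eigen V w.+1 lambda f ->
  set_eigen (V :\: [set j; k]) w (lambda + 1) (coord_diff j k f).
Proof.
move=> jk jV kV fE Y YV cY.
have jY : j \notin Y by apply/negP => /(subsetP YV); rewrite !inE eqxx.
have kY : k \notin Y by apply/negP => /(subsetP YV); rewrite !inE eqxx orbT.
have YV' : Y \subset V by apply: subset_trans YV (subsetDl _ _).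
have := fE (j |: Y); rewrite (@exchange_sum_split V j k) // cardsU1 jY cY subUset sub1set jV.
move=> /(_ YV' erefl) fj.
have := fE (k |: Y); rewrite (@exchange_sum_split V k j) 1?eq_sym 1?[[set k; j]]setUC //.
rewrite cardsU1 kY cY subUset sub1set kV => /(_ YV' erefl) fk.
rewrite /coord_diff mulrDl mul1r mulrBr fj fk.
rewrite [RHS](eq_bigr (fun a => \sum_(b in V :\: [set j; k] :\: Y) f (j |: exchange a b Y)
   - \sum_(b in V :\: [set j; k] :\: Y) f (k |: exchange a b Y))); last first.
  by move=> a _; rewrite sumrB.
rewrite sumrB; under [X in _ - (_ + X + _)]eq_bigr => a _ do rewrite setUCA.
ring.
Qed.


Lemma coord_diff0_const V w f X Z :
    (forall (j k : T) Y, j != k -> j \in V -> k \in V ->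
       Y \subset V :\: [set j; k] -> #|Y|.+1 = w -> f (j |: Y) = f (k |: Y)) ->
    X \subset V -> Z \subset V -> #|X| = w -> #|Z| = w -> f Z = f X.
Proof.
move=> f0 XV ZV cX cZ.
apply: (@exchange_connected V X Z (fun Z => f Z = f X)) => //; last by rewrite cZ.
move=> Y a b YV cY <- aY; rewrite inE => /andP[bY bV].
have cYa := cardsD1 a Y; rewrite aY in cYa.
rewrite -[in RHS](setD1K aY); apply: f0 => //; last by lia.
- by apply: contraNneq bY => ->.
- exact: (subsetP YV).
apply/subsetP => x; rewrite !inE => /andP[xa xY].
rewrite negb_or xa (subsetP YV) // !andbT; apply: contraNneq bY => <-.
exact: xY.
Qed.

Lemma exchange_sum_const V (c : R) X : X \subset V ->
  \sum_(a in X) \sum_(b in V :\: X) c = #|X|%:R * (#|V|%:R - #|X|%:R) * c.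
Proof.
move=> XV; rewrite !sumr_const cardsD (setIidPr XV) -mulrnA -[c *+ _]mulr_natl mulnC natrM.
by rewrite natrB // subset_leq_card.
Qed.

(** Maximum principle: the eigenvalue is the degree of the graph, so all
neighbours of a maximum are maxima. *)
Lemma top_eigen_const V w f X Z :
    set_eigen V w (w%:R * (#|V|%:R - w%:R)) f ->
    X \subset V -> Z \subset V -> #|X| = w -> #|Z| = w -> f Z = f X.
Proof.
move=> fE XV ZV /eqP cX /eqP cZ.
pose P (Y : {set T}) := (Y \subset V) && (#|Y| == w).
have PX : P X by apply/andP.
case: (@arg_maxP _ _ _ X P f PX) => M /andP[MV /eqP cM] fM.
suff H Y : P Y -> f Y = f M by rewrite !H //; apply/andP.
move=> /andP[YV /eqP cY].
apply: (@exchange_connected V M Y (fun Y => f Y = f M)) => //; last by rewrite cM.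
move=> {}Y a b {}YV {}cY fY aY bY.
have le0 a' b' : a' \in Y -> b' \in V :\: Y -> 0 <= f Y - f (exchange a' b' Y).
  rewrite inE => a'Y /andP[b'Y b'V]; rewrite subr_ge0 fY; apply: fM; apply/andP.
  by rewrite exchange_sub // exchange_card // cY cM.
have : \sum_(a in Y) \sum_(b in V :\: Y) (f Y - f (exchange a b Y)) = 0.
  under eq_bigr => ? _ do rewrite sumrB.
  by rewrite sumrB exchange_sum_const // cY cM -fE ?subrr // cY.
move=> /eqP; rewrite psumr_eq0; last by move=> a' a'Y; apply: sumr_ge0 => b' /le0; exact.
move=> /allP/(_ a); rewrite mem_index_enum aY => /(_ isT).
rewrite psumr_eq0; last by move=> b' /le0; exact.
move=> /allP/(_ b); rewrite mem_index_enum bY subr_eq0 fY => /(_ isT) /eqP.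
by [].
Qed.

(** At a nonzero [Y] of the difference, one of [j |: Y], [k |: Y] is a nonzero
of [f], and [Y] is recovered from it by removing [j] and [k]. *)
Lemma coord_diff_support_le V w f (j k : T) : j \in V -> k \in V ->
  (#|supp_on (V :\: [set j; k]) w (coord_diff j k f)| <=
   #|[set X in supp_on V w.+1 f | (j \in X) (+) (k \in X)]|)%N.
Proof.
move=> jV kV; have [->|jk] := eqVneq j k.
  suff -> : supp_on (V :\: [set k; k]) w (coord_diff k k f) = set0 by rewrite cards0.
  by apply/setP => x; rewrite !inE /coord_diff subrr eqxx !andbF.
pose g Y := if f (j |: Y) != 0 then j |: Y else k |: Y.
have notin Y : Y \in supp_on (V :\: [set j; k]) w (coord_diff j k f) ->
    (j \notin Y) /\ (k \notin Y).
  rewrite inE => /andP[YV _].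
  by split; apply/negP => /(subsetP YV); rewrite !inE eqxx ?orbT.
rewrite -(card_in_imset (f := g)); last first.
  have gK Y : Y \in supp_on (V :\: [set j; k]) w (coord_diff j k f) ->
      g Y :\: [set j; k] = Y.
    move=> /notin[jY kY]; apply/setP => x; rewrite /g.
    by case: ifP => _; rewrite !inE; have [->|_] /= := eqVneq x j;
      rewrite ?(negPf jY) //; have [->|_] /= := eqVneq x k; rewrite ?(negPf kY).
  by move=> Y1 Y2 /gK {2}<- /gK {2}<- ->.
apply/subset_leq_card/subsetP => _ /imsetP[Y Ys ->]; have [jY kY] := notin Y Ys.
move: Ys; rewrite in_supp_on => /and3P[YV /eqP cY fY].
have YV' : Y \subset V by exact: subset_trans YV (subsetDl _ _).
rewrite /g; case: ifPn => [fj|/negPn/eqP fj]; rewrite !inE subUset sub1set YV'.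
  by rewrite jV cardsU1 jY cY fj !eqxx eq_sym (negPf jk) (negPf kY).
rewrite kV cardsU1 kY cY !eqxx (negPf jk) (negPf jY) /= andbT.
by apply: contraNneq fY => fk; rewrite /coord_diff fj fk subrr.
Qed.

Lemma card_D2 V (j k : T) : j != k -> j \in V -> k \in V ->
  #|V :\: [set j; k]| = (#|V| - 2)%N.
Proof.
by move=> jk jV kV; rewrite cardsD (setIidPr _) ?cards2 ?jk // subUset !sub1set jV.
Qed.

Lemma coord_diff_johnson_eigen i V w f (j k : T) : j != k -> j \in V -> k \in V ->
    set_eigen V w.+1 (johnson_eigenvalue R i.+1 w.+1 #|V|) f ->
  set_eigen (V :\: [set j; k]) w
    (johnson_eigenvalue R i w #|V :\: [set j; k]|) (coord_diff j k f).
Proof.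
move=> jk jV kV fE; rewrite card_D2 //.
have V2 : (2 <= #|V|)%N.
  have := @subset_leq_card _ (mem [set j; k]) (mem V).
  by rewrite cards2 jk subUset !sub1set jV kV => ->.
have -> : johnson_eigenvalue R i w (#|V| - 2) =
          johnson_eigenvalue R i.+1 w.+1 #|V| + 1.
  by rewrite /johnson_eigenvalue natrB // -![in RHS]natr1; ring.
exact: coord_diff_eigen.
Qed.

(** If all differences vanish then [f] is constant, which is only possible for
[i = 0]; otherwise the induction hypothesis applies to a nonzero difference. *)
Lemma eigen_support_weak i V w f : (i <= w)%N ->
    set_eigen V w (johnson_eigenvalue R i w #|V|) f ->
    supp_on V w f != set0 ->
  ('C(#|V| - 2 * i, w - i) <= #|supp_on V w f|)%N.
Proof.
elim: i V w f => [|i IHi] V w f iw fE /set0Pn[X Xs].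
  move: Xs; rewrite inE => /and3P[XV /eqP cX fX].
  rewrite muln0 !subn0 -(cards_draws V w).
  apply/subset_leq_card/subsetP => Z; rewrite !inE => /andP[ZV /eqP cZ].
  rewrite ZV cZ eqxx /= (@top_eigen_const V w f X Z) //.
  by move: fE; rewrite /johnson_eigenvalue !subr0.
move: Xs; rewrite inE => /and3P[XV /eqP cX fX].
case: w => // w in iw fE cX *; rewrite ltnS in iw.
have Vw : (w.+1 <= #|V|)%N by rewrite -cX subset_leq_card.
case: (pickP [pred p : T * T * {set T} | [&& p.1.1 != p.1.2, p.1.1 \in V, p.1.2 \in V &
   p.2 \in supp_on (V :\: [set p.1.1; p.1.2]) w (coord_diff p.1.1 p.1.2 f)]]).
  move=> [[j k] Y] /= /and4P[jk jV kV Ys].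
  rewrite (_ : (#|V| - 2 * i.+1 = #|V :\: [set j; k]| - 2 * i)%N); last first.
    by rewrite card_D2 //; lia.
  rewrite subSS; apply: leq_trans (IHi _ _ (coord_diff j k f) iw _ _) _.
  - exact: coord_diff_johnson_eigen.
  - by apply/set0Pn; exists Y.
  apply: leq_trans (coord_diff_support_le _ _ jV kV) _.
  by apply/subset_leq_card/subsetP => Z; rewrite inE => /andP[].
move=> noY; have fc Z : Z \subset V -> #|Z| = w.+1 -> f Z = f X.
  move=> ZV cZ; apply: (@coord_diff0_const V w.+1) => // j k Y jk jV kV YV [cY].
  have := noY (j, k, Y); rewrite /= jk jV kV inE YV cY eqxx /= => /negPn.
  by rewrite subr_eq0 => /eqP.
have := fE X XV cX.
rewrite (eq_bigr (fun _ => \sum_(b in V :\: X) f X)) => [|a aX]; last first.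
  apply: eq_bigr => b; rewrite inE => /andP[bX bV].
  by rewrite fc ?exchange_sub ?exchange_card.
rewrite exchange_sum_const // cX => /(mulIf fX); rewrite /johnson_eigenvalue => eqn.
have : (i.+1 * (#|V|.+1 - i.+1))%:R = 0 :> R.
  rewrite natrM natrB; last lia.
  move/esym/eqP: eqn; rewrite -subr_eq0 => /eqP eqn; rewrite -[RHS]eqn -natr1.
  ring.
move/eqP; rewrite pnatr_eq0 muln_eq0 /=; lia.
Qed.

End Eigen.

(** * Traces and twin coordinates *)

Section Traces.
Local Open Scope nat_scope.
Variable T : finType.
Implicit Types (C S X Z : {set T}).

Lemma setIU_trace C S Z : S \subset C -> Z \subset ~: C -> (S :|: Z) :&: C = S.
Proof.
move=> SC ZC; rewrite setIUl (setIidPl SC); apply/setUidPl.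
by rewrite (_ : Z :&: C = set0) ?sub0set // disjoint_setI0 // disjoints_subset.
Qed.

Lemma cardU_trace C S Z : S \subset C -> Z \subset ~: C -> #|S :|: Z| = #|S| + #|Z|.
Proof.
move=> SC ZC; rewrite cardsU (_ : S :&: Z = set0) ?cards0 ?subn0 //.
by apply: disjoint_setI0; rewrite disjoints_subset (subset_trans SC) // subsetC.
Qed.

Lemma card_trace_fibre C S w : S \subset C -> #|S| <= w ->
  #|[set X : {set T} | (#|X| == w) && (X :&: C == S)]| = 'C(#|T| - #|C|, w - #|S|).
Proof.
move=> SC Sw; have -> : #|T| - #|C| = #|~: C| by rewrite -(cardsC C) addKn.
rewrite -cards_draws -[RHS](card_in_imset (f := fun Z => S :|: Z)); last first.
  move=> Z1 Z2; rewrite !inE => /andP[Z1C _] /andP[Z2C _] /setP eqZ.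
  apply/setP => x; have := eqZ x; rewrite !inE.
  case xS: (x \in S) => //= _; have xC := subsetP SC x xS.
  by apply/idP/idP => [/(subsetP Z1C)|/(subsetP Z2C)]; rewrite inE xC.
apply: eq_card => X; rewrite inE; apply/andP/imsetP.
  case=> /eqP cX /eqP XS; exists (X :\: C); last by rewrite -XS setID.
  by rewrite inE setDE subsetIr -setDE cardsD cX XS /=.
case=> Z; rewrite inE => /andP[ZC /eqP cZ] ->.
by rewrite (cardU_trace SC ZC) setIU_trace // cZ subnKC // !eqxx.
Qed.

(** With [C] of bounded size, a family of sets having fewer than [b] elements
outside [C] has size of order less than [n ^ b]. *)
Lemma card_thin C (F : {set {set T}}) b :
    (forall X, X \in F -> #|X :\: C| < b) ->
  #|F| <= 2 ^ #|C| * \sum_(a < b) 'C(#|T|, a).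
Proof.
move=> Fthin; pose g X := (X :&: C, X :\: C).
have g_inj : injective g.
  by move=> X Y [XY1 XY2]; rewrite -(setID X C) XY1 XY2 setID.
rewrite -(card_imset _ g_inj) -card_powerset.
have -> : \sum_(a < b) 'C(#|T|, a) = #|[set Z : {set T} | #|Z| < b]|.
  rewrite -sum1_card (eq_bigr (fun a : 'I_b => \sum_(Z : {set T} | #|Z| == a) 1)).
    rewrite (exchange_big_dep xpredT) //= [RHS]big_mkcond /=; apply: eq_bigr => Z _.
    rewrite inE; case: ifP => [Zb|bZ].
      by rewrite (big_pred1 (Ordinal Zb)).
    by apply: big1 => a /eqP aZ; have := ltn_ord a; rewrite -aZ bZ.
  move=> a _; rewrite -cardsT -cards_draws -sum1_card; apply: eq_bigl => Z.
  by rewrite inE subsetT.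
rewrite -cardsX; apply/subset_leq_card/subsetP => _ /imsetP[X XF ->].
by rewrite inE /= powersetE subsetIr inE Fthin.
Qed.
End Traces.

Section Twins.
Variables (R : realType) (T : finType) (w : nat) (f : {set T} -> R).
Implicit Types (X Y Z : {set T}) (j k l : T).

Definition twin j k := [forall Y : {set T},
  [&& #|Y|.+1 == w, j \notin Y & k \notin Y] ==> (f (j |: Y) == f (k |: Y))].

Lemma twinP j k : reflect (forall Y, #|Y|.+1 = w -> j \notin Y -> k \notin Y ->
  f (j |: Y) = f (k |: Y)) (twin j k).
Proof.
apply: (iffP forallP) => [jk Y cY jY kY|jk Y].
  by have := jk Y; rewrite cY eqxx jY kY => /eqP.
by apply/implyP => /and3P[/eqP cY jY kY]; rewrite jk.
Qed.

Lemma twin_refl j : twin j j. Proof. exact/twinP. Qed.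

Lemma twin_sym j k : twin j k -> twin k j.
Proof. by move=> /twinP jk; apply/twinP => Y cY kY jY; rewrite jk. Qed.

(** Twins are the coordinates whose transposition preserves [f], and the
transposition of [j], [l] is conjugate to that of [j], [k] by that of [k], [l]. *)
Lemma twin_trans k j l : twin j k -> twin k l -> twin j l.
Proof.
have [->|jl] := eqVneq j l; first by rewrite twin_refl.
move=> /twinP jk /twinP kl; apply/twinP => Y cY jY lY.
have [kY|kY] := boolP (k \in Y); last by rewrite jk ?kl.
have jnk : j != k by apply: contraNneq jY => ->.
have lnk : l != k by apply: contraNneq lY => ->.
have cYk := cardsD1 k Y; rewrite kY in cYk.
have jYk : j \notin Y :\ k by rewrite !inE (negPf jY) andbF.
have lYk : l \notin Y :\ k by rewrite !inE (negPf lY) andbF.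
rewrite -(setD1K kY) setUCA kl.
- rewrite setUCA jk ?(setUCA [set k]) //.
  + by rewrite cardsU1 lYk -cY cYk.
  + by rewrite !inE negb_or jl /= (negPf jY) andbF.
  + by rewrite !inE eq_sym (negPf lnk) eqxx.
- by rewrite cardsU1 jYk -cY cYk.
- by rewrite !inE eq_sym (negPf jnk) eqxx.
- by rewrite !inE negb_or eq_sym jl /= (negPf lY) andbF.
Qed.

Local Notation supp := (supp_on [set: T] w f).

(** Double counting of the triples [(j, k, X)] where [j], [k] are not twins and
[X] is a nonzero containing exactly one of them: a nonzero lies in at most
[2 * w * #|T|] of them. Some coordinate [k] has at most the average number of
non-twins. *)
Lemma twin_block (K s : nat) : (0 < K)%N -> (0 < #|T|)%N ->
    (forall j k, ~~ twin j k -> (K <= #|[set X in supp | (j \in X) (+) (k \in X)]|)%N) ->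
    (#|supp| <= s * K)%N ->
  exists k, (#|[set j | ~~ twin j k]| <= 2 * w * s)%N.
Proof.
move=> K_gt0 T_gt0 ntK suppK.
case: (pickP [pred k | #|[set j | ~~ twin j k]| <= 2 * w * s]%N) => [k|big_k].
  by exists k.
have lower : (#|T| * (2 * w * s).+1 * K <= \sum_k \sum_(j | ~~ twin j k) K)%N.
  rewrite -sum_nat_const big_distrl /=; apply: leq_sum => k _.
  rewrite sum_nat_const leq_mul2r; apply/orP; right.
  by have /negbT := big_k k; rewrite /= -ltnNge cardsE.
have upper : (\sum_k \sum_(j | ~~ twin j k) K <= #|supp| * (2 * w * #|T|))%N.
  apply: (@leq_trans (\sum_(k : T) \sum_(j : T) \sum_(X in supp) ((j \in X) + (k \in X)))%N).
    apply: leq_sum => k _; rewrite big_mkcond /=; apply: leq_sum => j _.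
    case: ifP => // /ntK le; apply: leq_trans le _.
    rewrite -sum1_card (eq_bigl _ _ (fun X => in_set _ X)) big_mkcondr /=.
    by apply: leq_sum => X _; case: (j \in X); case: (k \in X).
  under eq_bigr => k _ do rewrite exchange_big /=.
  rewrite exchange_big /= -sum_nat_const; apply: leq_sum => X.
  rewrite in_supp_on => /and3P[_ /eqP cX _].
  have sumX : (\sum_(j : T) (j \in X) = w)%N by rewrite -cX -sum1_card [RHS]big_mkcond.
  under eq_bigr => k _ do rewrite big_split /= sumX sum_nat_const.
  rewrite big_split /= -big_distrr /= sumX sum_nat_const.
  by rewrite -mulnDr addnn -mul2n mulnC leqnn.
have nK_gt0 : (0 < #|T| * K)%N by rewrite muln_gt0 T_gt0.
have := leq_trans lower (leq_trans upper (leq_mul suppK (leqnn _))).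
rewrite mulnAC mulnS (_ : s * K * _ = #|T| * K * (2 * w * s))%N; last by lia.
by rewrite -{2}[(_ * _ * (_ * _))%N]add0n leq_add2r leqNgt nK_gt0.
Qed.

(** Two [w]-sets with the same trace differ by exchanges of coordinates outside
[C], and these are twins through [k]. *)
Lemma twin_class_trace k X X' : let C := [set j | ~~ twin j k] in
  #|X| = w -> #|X'| = w -> X :&: C = X' :&: C -> f X = f X'.
Proof.
move=> C cX cX' XX'.
have XCC Y : Y :\: C \subset ~: C by rewrite setDE subsetIr.
have IC Y : Y :&: C \subset C by exact: subsetIr.
rewrite -(setID X' C) -XX'; apply/esym.
have cD : #|X' :\: C| = #|X :\: C|.
  by have := cardsID C X; have := cardsID C X'; rewrite XX'; lia.
apply: (@exchange_connected _ (~: C) (X :\: C) _ (fun Z => f (X :&: C :|: Z) = f X)) => //.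
- move=> Y a b YC cY <- aY; rewrite !inE => /andP[bY].
  rewrite negbK => bk.
  have aC := subsetP YC a aY; rewrite !inE negbK in aC.
  have ab : twin a b by apply: twin_trans aC (twin_sym bk).
  have aS : a \notin X :&: C by rewrite !inE aC andbF.
  have bS : b \notin X :&: C by rewrite !inE bk andbF.
  have cYa := cardsD1 a Y; rewrite aY in cYa.
  have aE : a \notin X :&: C :|: Y :\ a by rewrite in_setU (negPf aS) !inE eqxx.
  have YE : X :&: C :|: Y = a |: (X :&: C :|: Y :\ a) by rewrite setUCA setD1K.
  rewrite /exchange setUCA YE; apply/esym; apply: (twinP _ _ ab) => //.
    have := cardsU1 a (X :&: C :|: Y :\ a); rewrite -YE aE add1n => <-.
    by rewrite (cardU_trace (IC X)) // cY cardsID.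
  by rewrite in_setU (negPf bS) !inE (negPf bY) andbF.
- by rewrite setID.
Qed.
End Twins.

(** * Eigenfunctions of small support *)

Section Concentrated.
Variables (R : realType) (T : finType) (i w : nat) (f : {set T} -> R) (C : {set T}).
Implicit Types (X Y Z S U : {set T}).
Hypothesis f_trace : forall X X',
  #|X| = w -> #|X'| = w -> X :&: C = X' :&: C -> f X = f X'.

Local Notation supp := (supp_on [set: T] w f).

(** All the sets with the same trace as a nonzero are nonzeros. *)
Lemma trace_size_ge :
    (forall s, (s < i)%N -> (#|supp| < 'C(#|T| - #|C|, w - s))%N) ->
  forall X, #|X| = w -> f X != 0 -> (i <= #|X :&: C|)%N.
Proof.
move=> big X cX fX; rewrite leqNgt; apply/negP => /big; apply/negP; rewrite -leqNgt.
rewrite -card_trace_fibre ?subsetIr //; last by rewrite -cX subset_leq_card ?subsetIl.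
apply/subset_leq_card/subsetP => Y; rewrite inE in_supp_on subsetT.
by move=> /andP[/eqP cY /eqP YX]; rewrite cY eqxx /= (@f_trace Y X).
Qed.

Hypothesis f_low : forall X, #|X| = w -> f X != 0 -> (i <= #|X :&: C|)%N.
Hypothesis iw : (i <= w)%N.
Hypothesis C_small : (w < #|T| - #|C|)%N.

(** The value of [f] at any [w]-set with trace [S], on traces of size [i]; by
[f_trace] it does not depend on the chosen set. *)
Definition trace_fun S : R :=
  if [pick X : {set T} | (#|X| == w) && (X :&: C == S)] is Some X
  then if #|S| == i then f X else 0 else 0.

Lemma trace_fun_supp S : trace_fun S != 0 -> #|S| = i /\ S \subset C.
Proof.
rewrite /trace_fun; case: pickP => [X /andP[_ /eqP <-]|_]; last by rewrite eqxx.
by case: (#|X :&: C| =P i) => [-> _|_]; rewrite ?subsetIr // eqxx.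
Qed.

Lemma trace_funE X : #|X| = w -> #|X :&: C| = i -> trace_fun (X :&: C) = f X.
Proof.
move=> cX cXC; rewrite /trace_fun; case: pickP => [Y /andP[/eqP cY /eqP YX]|/(_ X)].
  by rewrite cXC eqxx; exact: f_trace.
by rewrite /= cX !eqxx.
Qed.

Lemma trace_exists S : S \subset C -> (#|S| <= w)%N ->
  exists2 X : {set T}, #|X| = w & X :&: C = S.
Proof.
move=> SC Sw.
have : (0 < #|[set X : {set T} | (#|X| == w) && (X :&: C == S)]|)%N.
  by rewrite card_trace_fibre // bin_gt0; lia.
by move=> /card_gt0P[X]; rewrite inE => /andP[/eqP cX /eqP XS]; exists X.
Qed.

(** This is the eigenvalue equation at a [w]-set [X] with trace [U]; as [f X = 0],
the values at the neighbours sum to zero. A neighbour has a trace of size at most [i - 1],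
hence value [0], unless an element [b] of [C] replaces an element outside [C];
the neighbour then has trace [b |: U], and each [b] is counted once for every
element of [X] outside [C]. *)
Lemma trace_fun_null (lambda : R) : set_eigen [set: T] w lambda f ->
  forall U, #|U|.+1 = i -> \sum_(b in ~: U) trace_fun (b |: U) = 0.
Proof.
move=> fE U cU; have [UC|UC] := boolP (U \subset C); last first.
  apply: big1 => b _; apply/eqP/contraT => /trace_fun_supp[_].
  by rewrite subUset (negPf UC) andbF.
have [|X cX XU] := trace_exists UC; first lia.
have fX : f X = 0.
  by apply/eqP/contraT => /(f_low cX); rewrite XU -cU ltnn.
have fex a b : a \in X -> b \in [set: T] :\: X ->
    f (exchange a b X) = if a \notin C then trace_fun (b |: U) else 0.
  rewrite inE => aX /andP[bX _].
  have cE : #|exchange a b X| = w by rewrite exchange_card.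
  have EC : exchange a b X :&: C = ([set b] :&: C) :|: (U :\ a).
    by rewrite setIUl setIDAC XU.
  case: ifPn => [aC|/negPn aC].
    have Ua : U :\ a = U.
      by apply/setDidPl; rewrite disjoint_sym disjoints1; apply: contra aC; apply: (subsetP UC).
    have bU : b \notin U by apply: contra bX; rewrite -XU inE => /andP[].
    rewrite Ua in EC; have [bC|bC] := boolP (b \in C).
      have bC1 : [set b] :&: C = [set b] by apply/setIidPl; rewrite sub1set.
      rewrite bC1 in EC.
      by rewrite -EC trace_funE // EC cardsU1 bU.
    have bC0 : [set b] :&: C = set0 by apply: disjoint_setI0; rewrite disjoints1.
    rewrite bC0 set0U in EC.
    have -> : trace_fun (b |: U) = 0.
      by apply/eqP/contraT => /trace_fun_supp[_]; rewrite subUset sub1set (negPf bC).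
    by apply/eqP/contraT => /(f_low cE); rewrite EC -cU ltnn.
  apply/eqP/contraT => /(f_low cE); rewrite EC => le; exfalso; move: le; apply/negP.
  rewrite -ltnNge.
  have aU : a \in U by rewrite -XU inE aX.
  have := cardsD1 a U; rewrite aU => cUa.
  apply: leq_ltn_trans (_ : (1 + #|U :\ a| < i)%N); last lia.
  apply: leq_trans (leq_card_setU _ _) _; rewrite leq_add2r -(cards1 b).
  exact/subset_leq_card/subsetIl.
have := fE X (subsetT X) cX; rewrite fX mulr0.
under eq_bigr => a aX do under eq_bigr => b bX do rewrite (fex a b aX bX).
rewrite (bigID (mem C)) /= big1 ?add0r; last first.
  by move=> a /andP[_ aC]; apply: big1 => b _; rewrite aC.
rewrite (eq_bigr (fun _ => \sum_(b in [set: T] :\: X) trace_fun (b |: U))); last first.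
  by move=> a /andP[_ ->].
rewrite sumr_const => /esym/eqP; rewrite mulrn_eq0 => /orP[/eqP c0|/eqP sum0].
  have cD : #|X :\: C| = 0%N.
    by rewrite -[RHS]c0; apply: eq_card => a; rewrite !inE andbC.
  have := cardsID C X; rewrite XU cX; lia.
rewrite -[RHS]sum0 (bigID (mem X)) /= big1 ?add0r.
  apply: eq_bigl => b; rewrite !inE andbT andbC.
  by case: (boolP (b \in X)) => //= bX; apply: contra bX; rewrite -XU inE => /andP[].
move=> b; rewrite inE => /andP[bU bX].
apply/eqP/contraT => /trace_fun_supp[_]; rewrite subUset sub1set => /andP[bC _].
by rewrite -XU inE bX bC in bU.
Qed.

Lemma card_trace_level :
  #|[set X in supp | #|X :&: C| == i]| =
  (#|[set S | trace_fun S != 0%R]| * 'C(#|T| - #|C|, w - i))%N.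
Proof.
rewrite -sum1_card (partition_big (fun X => X :&: C) (mem [set S | trace_fun S != 0])) /=.
  rewrite -sum_nat_const; apply: eq_bigr => S; rewrite inE => hS.
  have [cS SC] := trace_fun_supp hS.
  rewrite -[in RHS]cS -card_trace_fibre ?cS // -sum1_card; apply: eq_bigl => X.
  rewrite !inE subsetT /=; case: (X :&: C =P S) => [XS|]; last by rewrite !andbF.
  rewrite XS cS eqxx !andbT; case: (#|X| =P w) => //= cX.
  by rewrite -(trace_funE cX) XS.
move=> X; rewrite !inE subsetT /= => /andP[/andP[/eqP cX fX] /eqP cXC].
by rewrite trace_funE.
Qed.
End Concentrated.

(** The three inequalities on binomial coefficients hold for large [n]; [L] is
the bound that [twin_block] gives on the number of coordinates outside the
large class of twins. *)
Lemma small_support_structure (R : realType) (T : finType) (i w : nat)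
    (f : {set T} -> R) :
    let n := #|T| in let L := (2 * w * 2 ^ i)%N in
    (0 < i)%N -> (i <= w)%N -> (L + w < n)%N ->
    (forall b, (b <= w)%N ->
       (2 ^ L * \sum_(a < b) 'C(n, a) < 'C(n - 2 * i, b))%N) ->
    (forall b, (b <= w)%N ->
       (2 ^ i * \sum_(a < b) 'C(n, a) < 'C(n - L, b))%N) ->
    (forall b, (b <= w)%N ->
       (2 ^ i * 'C(n, b) < (2 ^ i).+1 * 'C(n - L, b))%N) ->
    set_eigen [set: T] w (johnson_eigenvalue R i w n) f ->
    supp_on [set: T] w f != set0 ->
    (#|supp_on [set: T] w f| <= 2 ^ i * 'C(n - 2 * i, w - i))%N ->
  (2 ^ i * 'C(n - 2 * i, w - i) <= #|supp_on [set: T] w f|)%N /\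
  exists (M : {set T}) (phi : T -> T) (c : R),
    [/\ #|M| = i, [disjoint M & phi @: M], {in M &, injective phi} &
        forall X : {set T}, #|X| = w -> f X = c *
          (if is_pair_transversal M (phi @: M) phi X
           then (-1) ^+ #|M :&: X| else 0)].
Proof.
move=> n L i_gt0 iw Ln G1 G2 G3 fE supp0 small.
set supp := supp_on _ _ _ in supp0 small *.
set K := 'C(n - 2 * i, w - i) in small *.
have Lge : (2 * i <= L)%N.
  have : (0 < 2 ^ i)%N by rewrite expn_gt0.
  by rewrite /L; move: (2 ^ i)%N => p *; nia.
have K_gt0 : (0 < K)%N by rewrite bin_gt0; lia.
have n_gt0 : (0 < n)%N by lia.
have weak : (K <= #|supp|)%N.
  by have := @eigen_support_weak R T i setT w f iw; rewrite cardsT; apply.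
have w_gt0 : (0 < w)%N by lia.
have diff_ge j k : ~~ twin w f j k ->
    (K <= #|supp_on ([set: T] :\: [set j; k]) w.-1 (coord_diff j k f)|)%N.
  move=> njk.
  have jk : j != k by apply: contraNneq njk => ->; exact: twin_refl.
  have jkE : set_eigen ([set: T] :\: [set j; k]) w.-1
      (johnson_eigenvalue R i.-1 w.-1 #|[set: T] :\: [set j; k]|) (coord_diff j k f).
    apply: coord_diff_johnson_eigen; rewrite ?inE //.
    by rewrite !prednK // cardsT.
  have -> : K = 'C(#|[set: T] :\: [set j; k]| - 2 * i.-1, w.-1 - i.-1).
    by rewrite card_D2 ?inE // cardsT /K; congr ('C(_, _)); lia.
  apply: eigen_support_weak jkE _; first by lia.
  apply/set0Pn; move: njk; rewrite negb_forall => /existsP[Y].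
  rewrite negb_imply => /andP[/and3P[/eqP cY jY kY] fY]; exists Y.
  rewrite in_supp_on -cY eqxx subr_eq0 fY andbT andbT.
  apply/subsetP => x xY; rewrite !inE andbT negb_or.
  by apply/andP; split; [apply: contraNneq jY => <-|apply: contraNneq kY => <-].
(* [C] collects the coordinates outside the large class of twins. *)
have [k0 C_le] : exists k, (#|[set j | ~~ twin w f j k]| <= L)%N.
  apply: (@twin_block R T w f K (2 ^ i)) => // j k /diff_ge le.
  apply: leq_trans le _; rewrite -[w in X in (_ <= X)%N](prednK w_gt0).
  by apply: coord_diff_support_le; rewrite inE.
set C := [set j | _] in C_le.
have f_trace (X X' : {set T}) : #|X| = w -> #|X'| = w -> X :&: C = X' :&: C -> f X = f X'.
  exact: twin_class_trace.
(* A smaller trace would yield a number of nonzeros of order above [n ^ (w - i)]. *)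
have f_low : forall X : {set T}, #|X| = w -> f X != 0 -> (i <= #|X :&: C|)%N.
  apply: trace_size_ge => // s si.
  apply: leq_ltn_trans small _.
  apply: leq_trans (_ : 'C(n - L, w - s) <= _)%N; last by rewrite leq_bin2l; lia.
  apply: leq_ltn_trans (G2 (w - s)%N _); last by lia.
  rewrite leq_mul2l; apply/orP; right.
  have lt : (w - i < w - s)%N by lia.
  rewrite (bigD1 (Ordinal lt)) //=; apply: leq_trans (leq_addr _ _).
  by rewrite leq_bin2l; lia.
have C_small : (w < #|T| - #|C|)%N by rewrite -/n; lia.
pose h := trace_fun i w f C.
have hU S : h S != 0 -> #|S| = i by case/trace_fun_supp.
have hN := trace_fun_null f_trace f_low iw C_small fE.
have level := card_trace_level f_trace iw.
set hs := [set S | trace_fun i w f C S != 0] in level; rewrite -/n in level.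
have thin (F : {set {set T}}) : (forall X, X \in F -> #|X :\: C| < w - i)%N ->
    (#|F| < K)%N.
  move=> /card_thin le; apply: leq_ltn_trans le _.
  apply: leq_ltn_trans (G1 _ (leq_subr i w)); rewrite leq_mul2r; apply/orP; right.
  by rewrite leq_exp2l.
(* If no nonzero had a trace of size [i], the support would be too thin. *)
have [S hS] : exists S, h S != 0.
  case: (pickP (fun S => h S != 0)) => [S hS|h0]; first by exists S.
  suff : (#|supp| < K)%N by rewrite ltnNge weak.
  apply: thin => X; rewrite in_supp_on => /and3P[_ /eqP cX fX].
  have := f_low X cX fX; rewrite leq_eqVlt => /orP[/eqP cXC|].
    by have := h0 (X :&: C); rewrite /h trace_funE // fX.
  by have := cardsID C X; rewrite cX; lia.
(* The nonzeros with a trace of size [i] alone exceed the bound if [h] has more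
   than [2 ^ i] nonzeros. *)
have hs_le : (#|hs| <= 2 ^ i)%N.
  rewrite leqNgt; apply/negP => hs_big.
  have : ((2 ^ i).+1 * 'C(n - L, w - i) <= 2 ^ i * 'C(n, w - i))%N.
    apply: leq_trans (_ : #|hs| * 'C(n - #|C|, w - i) <= _)%N.
      by apply: leq_mul => //; rewrite leq_bin2l; lia.
    rewrite -level; apply: leq_trans (leq_trans small _).
      by apply/subset_leq_card/subsetP => X; rewrite inE => /andP[].
    by rewrite leq_mul2l leq_bin2l ?orbT; lia.
  by rewrite leqNgt G3 // leq_subr.
have hs_eq : #|hs| = (2 ^ i)%N.
  by apply/eqP; rewrite eqn_leq hs_le (null_design_support_ge hU hN hS).
have [phi [disj inj hphi hsub hval]] := min_null_design_structure hU hN hs_eq hS.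
have cS := hU S hS.
have SMC A : h A != 0 -> A \subset C by case/trace_fun_supp.
have MMC : S :|: phi @: S \subset C.
  rewrite subUset SMC //=; apply/subsetP => _ /imsetP[a aS ->].
  by apply: (subsetP (SMC _ (hphi a aS))); rewrite setU11.
(* For [j] in [C] outside the pairs, the difference along [j] and [k0] vanishes
   on the sets whose trace has fewer than [i] elements, so its support is thin. *)
have CE : C = S :|: phi @: S.
  apply/eqP; rewrite eqEsubset MMC andbT; apply/subsetP => j jC; apply: contraT => jS.
  have njk : ~~ twin w f j k0 by move: jC; rewrite inE.
  have k0C : k0 \notin C by rewrite inE negbK twin_refl.
  suff : (#|supp_on (setT :\: [set j; k0]) w.-1 (coord_diff j k0 f)| < K)%N.
    by rewrite ltnNge diff_ge.
  apply: thin => Y; rewrite in_supp_on => /and3P[YV /eqP cY fY].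
  have jY : j \notin Y by apply/negP => /(subsetP YV); rewrite !inE eqxx.
  have kY : k0 \notin Y by apply/negP => /(subsetP YV); rewrite !inE eqxx orbT.
  suff : (i <= #|Y :&: C|)%N.
    by have := cardsID C Y; rewrite cY; clear -iw w_gt0; lia.
  rewrite leqNgt; apply: contra fY => YC; rewrite /coord_diff.
  have ck : #|k0 |: Y| = w by rewrite cardsU1 kY cY add1n prednK.
  have cj : #|j |: Y| = w by rewrite cardsU1 jY cY add1n prednK.
  have kC : (k0 |: Y) :&: C = Y :&: C.
    by rewrite setIUl (disjoint_setI0 (_ : [disjoint [set k0] & C])) ?set0U ?disjoints1.
  have jCE : (j |: Y) :&: C = j |: (Y :&: C).
    by rewrite setIUl; congr (_ :|: _); apply/setIidPl; rewrite sub1set.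
  have -> : f (k0 |: Y) = 0.
    by apply/eqP/contraT => /(f_low _ ck); rewrite kC leqNgt YC.
  rewrite subr0; apply/contraT => fj; have := f_low _ cj fj.
  rewrite jCE cardsU1 inE (negPf jY) /= => le.
  have cji : #|(j |: Y) :&: C| = i.
    by rewrite jCE cardsU1 inE (negPf jY) /=; apply/eqP; rewrite eqn_leq le andbT.
  have := hsub ((j |: Y) :&: C); rewrite /h trace_funE // fj => /(_ isT).
  by rewrite jCE subUset sub1set (negPf jS).
have cC : #|C| = (2 * i)%N.
  by rewrite CE cardsU (disjoint_setI0 disj) cards0 card_in_imset // cS; lia.
rewrite hs_eq cC -/K in level.
(* The nonzeros with a trace of size [i] already exhaust the bound. *)
have lev_sub : [set X in supp | #|X :&: C| == i] \subset supp.
  by apply/subsetP => X; rewrite inE => /andP[].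
split; first by rewrite -level subset_leq_card.
have lev_eq : [set X in supp | #|X :&: C| == i] = supp.
  by apply/eqP; rewrite eqEcard lev_sub level.
exists S, phi, ((-1) ^+ i * h S); split=> // X cX.
have [cXC|cXC] := eqVneq #|X :&: C| i.
  rewrite -(trace_funE f_trace cX cXC) -/h (hval (X :&: C)); last by rewrite -CE subsetIr.
  have I1 (A : {set T}) : A \subset C -> X :&: C :&: A = X :&: A.
    by move=> AsubC; rewrite -setIA (setIidPr AsubC).
  have SC : S \subset C by rewrite CE subsetUl.
  have S'C : phi @: S \subset C by rewrite CE subsetUr.
  rewrite /is_pair_transversal I1 -?CE // !I1 //.
  by rewrite [S :&: (X :&: C)]setIC I1 // [X :&: S]setIC.
have -> : f X = 0.
  apply/eqP/contraT => fX; have : X \in supp by rewrite in_supp_on subsetT cX eqxx.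
  by rewrite -lev_eq inE (negPf cXC) andbF.
by rewrite /is_pair_transversal -CE cS (negPf cXC) mulr0.
Qed.

(** * From binary vectors to sets *)

Section Transport.
Variables (R : realType) (n w : nat).
Implicit Types (x y : jvertex n w) (X Y : {set 'I_n}) (f : jvertex n w -> R).

Definition bvec_of X : bvec n := [ffun k => k \in X].

Lemma bvec_ofK X : bsupp (bvec_of X) = X.
Proof. by apply/setP => k; rewrite inE ffunE. Qed.

Lemma bsuppK (x : bvec n) : bvec_of (bsupp x) = x.
Proof. by apply/ffunP => k; rewrite ffunE inE. Qed.

Lemma jsupp_card x : #|jsupp x| = w.
Proof. exact: eqP (valP x). Qed.

Lemma jsupp_inj : injective (@jsupp n w).
Proof.
by move=> x y xy; apply: val_inj; rewrite -(bsuppK (val x)) -(bsuppK (val y)); congr bvec_of.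
Qed.

Lemma jsupp_surj X : #|X| = w -> exists x, jsupp x = X.
Proof.
move=> cX; have cX' : #|bsupp (bvec_of X)| == w by rewrite bvec_ofK cX.
by exists (Sub (bvec_of X) cX'); rewrite /jsupp SubK bvec_ofK.
Qed.

(** Sets that are not of size [w] receive the value [0]. *)
Definition set_fun f X : R := oapp f 0 (insub (bvec_of X)).

Lemma set_funE f x : set_fun f (jsupp x) = f x.
Proof. by rewrite /set_fun /jsupp bsuppK valK. Qed.

Lemma exchange_inj X :
  {in setX X (~: X) &, injective (fun p : 'I_n * 'I_n => exchange p.1 p.2 X)}.
Proof.
have exD a b : a \in X -> b \notin X ->
    X :\: exchange a b X = [set a] /\ exchange a b X :\: X = [set b].
  move=> aX bX; split; apply/setP => c; rewrite !inE.
    have [->|ca] /= := eqVneq c a; last by case: (c \in X); rewrite ?orbT ?andbF.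
    by rewrite aX orbF andbT; apply: contraNneq bX => <-.
  have [->|cb] /= := eqVneq c b; first by rewrite bX.
  by case: (c \in X); rewrite ?andbF.
move=> [a b] [a' b']; rewrite !inE /= => /andP[aX bX] /andP[a'X b'X] eqE.
have [Da Db] := exD a b aX bX; have [Da' Db'] := exD a' b' a'X b'X.
move: Da' Db'; rewrite -eqE Da Db => /set1_inj -> /set1_inj ->.
by [].
Qed.

Lemma johnson_nbhd x : (0 < w)%N ->
  [set jsupp y | y in johnson x] =
  [set exchange p.1 p.2 (jsupp x) | p in setX (jsupp x) (~: jsupp x)].
Proof.
move=> w_gt0; set X := jsupp x; have cX : #|X| = w by exact: jsupp_card.
apply/setP => Y; apply/imsetP/imsetP.
  case=> y; rewrite unfold_in => /eqP cI ->.
  have := cardsID (jsupp y) X; rewrite cX cI => cXY.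
  have := cardsID X (jsupp y); rewrite jsupp_card setIC cI => cYX.
  have /cards1P[a Xa] : #|X :\: jsupp y| == 1%N by apply/eqP; lia.
  have /cards1P[b Yb] : #|jsupp y :\: X| == 1%N by apply/eqP; lia.
  have aX : a \in X by have := set11 a; rewrite -Xa inE => /andP[].
  have bX : b \notin X by have := set11 b; rewrite -Yb inE => /andP[].
  exists (a, b); first by rewrite in_setX in_setC aX bX.
  rewrite /=; by rewrite -{1}(setID (jsupp y) X) Yb setUC setIC /exchange -Xa setDDr setDv set0U.
case=> -[a b]; rewrite in_setX in_setC /= => /andP[aX bX] ->.
have [y yE] : exists y, jsupp y = exchange a b X.
  by apply: jsupp_surj; rewrite exchange_card.
exists y => //; rewrite unfold_in /johnson yE -/X.
have -> : X :&: exchange a b X = X :\ a.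
  apply/setP => c; rewrite in_setI in_setU1 !in_setD1; have [->|_] /= := eqVneq c b.
    by rewrite (negPf bX) andbF.
  by case: (c \in X); rewrite ?andbF ?andbT.
by have := cardsD1 a X; rewrite aX cX => ->.
Qed.

Lemma set_fun_eigen lambda f : (0 < w)%N ->
  eigenfunction (@johnson n w) lambda f -> set_eigen [set: 'I_n] w lambda (set_fun f).
Proof.
move=> w_gt0 fE X _ /jsupp_surj[x <-]; rewrite set_funE fE setTD.
transitivity (\sum_(Y in [set jsupp y | y in johnson x]) set_fun f Y).
  rewrite big_imset /=; first by apply: eq_bigr => y _; rewrite set_funE.
  by move=> y z _ _; exact: jsupp_inj.
rewrite johnson_nbhd // big_imset /=; last exact: exchange_inj.
rewrite pair_big_dep /=; apply: eq_bigl => p; rewrite inE //.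
Qed.

Lemma set_fun_supp_card f : #|supp_on [set: 'I_n] w (set_fun f)| = #|fsupp f|.
Proof.
rewrite -(card_imset _ jsupp_inj); apply: eq_card => X.
rewrite in_supp_on subsetT /=; apply/andP/imsetP.
  by case=> /eqP/jsupp_surj[x <-]; rewrite set_funE => fx; exists x; rewrite ?inE.
by case=> x; rewrite inE => fx ->; rewrite jsupp_card set_funE.
Qed.
End Transport.

Theorem theorem4 (R : realType) (i w : nat) (i_gt0 : (0 < i)%N)
    (le_iw : (i <= w)%N) :
  exists n0 : nat, forall n : nat, (n0 <= n)%N ->
  forall f : jvertex n w -> R,
    eigenfunction (@johnson n w) (johnson_eigenvalue R i w n) f ->
    (exists x, f x != 0) ->
    (2 ^ i * 'C(n - 2 * i, w - i) <= #|fsupp f|)%N /\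
    (#|fsupp f| = (2 ^ i * 'C(n - 2 * i, w - i))%N ->
     exists (M M' : {set 'I_n}) (phi : 'I_n -> 'I_n) (c : R),
       is_pairing i M M' phi /\
       forall x, f x = c * min_eigenfun R i M M' phi x).
Proof.
pose L := (2 * w * 2 ^ i)%N.
have [n1 G1] := bin_growth (2 ^ L) (2 * i) w.
have [n2 G2] := bin_growth (2 ^ i) L w.
have [n3 G3] := bin_shift (2 ^ i) L w.
exists (maxn (L + w).+1 (maxn n1 (maxn n2 n3))) => n.
rewrite !geq_max => /and4P[Ln n1n n2n n3n] f fE [x0 fx0].
have w_gt0 : (0 < w)%N by exact: leq_trans le_iw.
have supp0 : supp_on [set: 'I_n] w (set_fun f) != set0.
  by apply/set0Pn; exists (jsupp x0); rewrite in_supp_on subsetT jsupp_card eqxx set_funE.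
have := @small_support_structure R 'I_n i w (set_fun f).
rewrite /= card_ord => /(_ i_gt0 le_iw Ln (fun b => G1 n b n1n) (fun b => G2 n b n2n)
  (fun b => G3 n b n3n) (set_fun_eigen w_gt0 fE) supp0) structure.
rewrite set_fun_supp_card in structure; split.
  by rewrite leqNgt; apply/negP => lt; have [] := structure (ltnW lt); rewrite leqNgt lt.
move=> eq; have [_ [M [phi [c [cM disj inj fval]]]]] := structure (eq_leq eq).
exists M, (phi @: M), phi, c; split.
  by split=> //; rewrite card_in_imset.
by move=> x; rewrite -set_funE fval ?jsupp_card // /is_pair_transversal cM.
Qed.
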